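(* For $k \in \mathbb{N}$ let $V_k = ((n-1)k+1)_{n \geq 1}$ and $W_k = (k^{n-1})_{n \geq 1}$. Then: (1) the GD sequences $V_k$ are maximal for $k = 2, 3$, but are not maximal for $k \geq 4$; and (2) the GD sequences $W_k$ are not maximal for all $k \geq 3$.
   Context: $\mathbb{N}$ denotes the set of positive integers, and $k$ is an integer throughout. For a sequence $S$, the notation $a \in S$ means that $a$ is one of the terms of $S$. A GD sequence is an increasing (infinite) sequence $S = (a_n)_{n \geq 1}$ of positive integers satisfying the following two properties: ($\mathcal{P}_1$) for every $n \in \mathbb{N}$ and $m \in \mathbb{N}$, $a_m a_n \in S$; and ($\mathcal{P}_2$) for every $n \in \mathbb{N}$ and $m \in \mathbb{N}$, $a_m + a_n \notin S$ (the case $m = n$ is included in both properties). A GD sequence $S$ is called maximal if there is no GD sequence $S_1$ such that $S$ is a proper subsequence of $S_1$. The sequence $V_k$ (the positive integers congruent to $1$ modulo $k$, in increasing order) is a GD sequence for $k \geq 2$, and the sequence $W_k$ (the powers $1, k, k^2, \dots$) is a GD sequence for $k \geq 3$. *)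

(* Defs.v *)
(* An infinite sequence (a_n)_{n >= 1} is a function [a : nat -> nat] numbered
   from 0, so that [a i] is the term a_(i+1). *)
From mathcomp Require Import all_boot.

Set Implicit Arguments.
Unset Strict Implicit.
Unset Printing Implicit Defensive.

Definition is_term (x : nat) (a : nat -> nat) : Prop := exists n, a n = x.

(* "Increasing" is strict: repeated terms are excluded. *)
Definition increasing (a : nat -> nat) : Prop := {homo a : m n / m < n}.

Definition GD (a : nat -> nat) : Prop :=
  [/\ increasing a,
      forall n, 0 < a n,
      forall n m, is_term (a m * a n) a
    & forall n m, ~ is_term (a m + a n) a].

Definition subsequence (a b : nat -> nat) : Prop :=
  exists2 phi : nat -> nat, increasing phi & forall n, a n = b (phi n).

Definition proper_subsequence (a b : nat -> nat) : Prop :=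
  subsequence a b /\ ~ (forall n, a n = b n).

Definition maximal_GD (a : nat -> nat) : Prop :=
  GD a /\ ~ (exists b : nat -> nat, GD b /\ proper_subsequence a b).

(* With n = i + 1, the term (n - 1) k + 1 is i * k + 1 and k^(n-1) is k ^ i. *)
Definition V (k : nat) : nat -> nat := fun i => i * k + 1.

Definition W (k : nat) : nat -> nat := fun i => k ^ i.

(* Main.v *)
Require Import Defs.
From mathcomp Require Import all_boot zify.

(** A GD sequence is determined by its set of terms, so everything reduces to
    sets of positive integers closed under product and disjoint from their
    sumset; a set of residues modulo [k] with these two properties gives such a
    set of integers ([GD_residues]).

    The residue set {1} makes [V k] a GD sequence for [k >= 2].  For [k = 2]
    nothing can be added, since an even [x] would give the odd number [x + 1].
    For [k = 3] nothing can be added either: [x + 1] has residue 1 if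
    [x = 0 mod 3], and [x + x] has residue 1 if [x = 2 mod 3].  For [k >= 4]
    the residue set {1, -1} is still closed under product and its sums
    2, 0, -2 still avoid it, so the integers congruent to 1 or -1 modulo [k]
    form a strictly larger GD sequence.

    For [k >= 3] a sum of two powers of [k] lies strictly between two consecutive
    powers, so [W k] is a GD sequence.  Every power of [k] is congruent to 1
    modulo [k - 1], so [W k] sits inside the GD sequence [V (k - 1)], and
    properly: [2k - 1] is a term of the latter only. *)

(** * Increasing sequences and their sets of terms *)

Lemma increasing_step (a : nat -> nat) :
  (forall n, a n < a n.+1) -> increasing a.
Proof. exact: (homo_ltn ltn_trans). Qed.

Lemma increasing_ltn (a : nat -> nat) m n :
  increasing a -> (a m < a n) = (m < n).
Proof. by move=> /leq_mono/leqW_mono/(_ m n). Qed.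

(** Below [b n], itself a term of [a], there are the [n] terms [b 0], ...,
    [b n.-1] of [a], so [b n] has index at least [n] in [a]. *)
Lemma increasing_leq_terms (a b : nat -> nat) :
  increasing a -> increasing b -> (forall n, is_term (b n) a) ->
  forall n, a n <= b n.
Proof.
move=> inca incb b_in_a; elim=> [|n IHn].
  by have [m <-] := b_in_a 0; rewrite (leq_mono inca).
have [m def_bn1] := b_in_a n.+1; rewrite -def_bn1 (leq_mono inca).
by rewrite -(increasing_ltn _ _ _ inca) def_bn1 (leq_ltn_trans IHn) ?incb.
Qed.

Lemma increasing_eq_terms (a b : nat -> nat) :
  increasing a -> increasing b ->
  (forall n, is_term (a n) b) -> (forall n, is_term (b n) a) -> a =1 b.
Proof.
by move=> inca incb a_in_b b_in_a n; apply/eqP; rewrite eqn_leq !increasing_leq_terms.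
Qed.

Lemma subsequence_terms (a b : nat -> nat) :
  increasing a -> increasing b -> (forall n, is_term (a n) b) ->
  subsequence a b.
Proof.
move=> inca incb a_in_b.
have ex_idx n : exists m, b m == a n by have [m /eqP] := a_in_b n; exists m.
have idxP n : b (xchoose (ex_idx n)) = a n by exact/eqP/(xchooseP (ex_idx n)).
exists (fun n => xchoose (ex_idx n)) => [m n lt_mn|n]; last by rewrite idxP.
by rewrite -(increasing_ltn _ _ _ incb) !idxP inca.
Qed.

Lemma maximal_GD_terms (a : nat -> nat) : GD a ->
  (forall b, GD b -> (forall n, is_term (a n) b) ->
     forall m, is_term (b m) a) ->
  maximal_GD a.
Proof.
move=> GDa max_a; split=> // -[b [GDb [[phi _ def_a] neq_ab]]].
have a_in_b n : is_term (a n) b by exists (phi n).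
have [[inca _ _ _] [incb _ _ _]] := (GDa, GDb).
exact/neq_ab/increasing_eq_terms/max_a.
Qed.

Lemma not_maximal_GD_terms (a b : nat -> nat) x : GD a -> GD b ->
  (forall n, is_term (a n) b) -> is_term x b -> ~ is_term x a ->
  ~ maximal_GD a.
Proof.
move=> [inca _ _ _] GDb a_in_b [m def_x] x_notin_a [_]; apply; exists b; split=> //.
have [incb _ _ _] := GDb; split; first exact: subsequence_terms.
by move=> eq_ab; apply: x_notin_a; exists m; rewrite eq_ab.
Qed.

(** * GD sequences defined by residues *)

Lemma GD_residues k (R : pred nat) (a : nat -> nat) :
  increasing a -> (forall x, is_term x a <-> R (x %% k)) ->
  (forall r s, R r -> R s -> R ((r * s) %% k)) ->
  (forall r s, R r -> R s -> ~~ R ((r + s) %% k)) ->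
  GD a.
Proof.
move=> inca memP closedM sumfree.
have Ra n : R (a n %% k) by apply/memP; exists n.
split=> // [n|n m|n m].
- (* the residue 0 is excluded because 0 + 0 = 0 *)
  rewrite lt0n; apply/eqP=> an0; have := Ra n; rewrite an0 mod0n => R0.
  by have := sumfree 0 0 R0 R0; rewrite mod0n R0.
- by apply/memP; rewrite -modnMm closedM.
- by move/memP; rewrite -modnDm; apply/negP/sumfree.
Qed.

Lemma is_term_V k x : 1 < k -> is_term x (V k) <-> x %% k == 1.
Proof.
move=> k_gt1; split=> [[n <-]|/eqP x1]; first by rewrite /V modnMDl modn_small.
by exists (x %/ k); rewrite /V -[in LHS]x1 -divn_eq.
Qed.

Lemma GD_V k : 1 < k -> GD (V k).
Proof.
move=> k_gt1; apply: (@GD_residues k (pred1 1)).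
- by apply: increasing_step => n; rewrite /V; lia.
- by move=> x; apply: is_term_V.
- by move=> r s /eqP-> /eqP->; rewrite /= modn_small.
- move=> r s /eqP-> /eqP->; rewrite /= addn1.
  by have [->|k_neq2] := eqVneq k 2; last rewrite modn_small //; lia.
Qed.

Lemma maximal_GD_V2 : maximal_GD (V 2).
Proof.
apply: maximal_GD_terms => [|b [_ _ _ sumfree] V_in_b m]; first exact: GD_V.
have V_b x : x %% 2 == 1 -> is_term x b.
  by move/(is_term_V 2 x isT)=> [n <-].
apply/(is_term_V 2 _ isT); apply: contraT => bm_even.
have [n bn1] := V_b 1 isT.
by case: (sumfree m n); apply: V_b; rewrite bn1; lia.
Qed.

Lemma maximal_GD_V3 : maximal_GD (V 3).
Proof.
apply: maximal_GD_terms => [|b [_ _ _ sumfree] V_in_b m]; first exact: GD_V.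
have V_b x : x %% 3 == 1 -> is_term x b.
  by move/(is_term_V 3 x isT)=> [n <-].
apply/(is_term_V 3 _ isT); apply: contraT => bm_neq1.
have [n bn1] := V_b 1 isT.
have [bm0|bm_neq0] := eqVneq (b m %% 3) 0.
  by case: (sumfree m n); apply: V_b; rewrite bn1; lia.
by case: (sumfree m m); apply: V_b; lia.
Qed.

(** For [k > 2], the increasing enumeration of the positive integers congruent
    to 1 or -1 modulo [k]: each interval from [q * k] to [q * k + k.-1] contains
    one integer of either kind, at the indices [2 * q] and [2 * q + 1]. *)
Definition V_pm (k i : nat) : nat := i./2 * k + (if odd i then k.-1 else 1).

Lemma is_term_V_pm k x : 1 < k ->
  is_term x (V_pm k) <-> (x %% k == 1) || (x %% k == k.-1).
Proof.
move=> k_gt1; split=> [[n <-]|/orP[]/eqP def_r].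
- rewrite /V_pm modnMDl; case: odd; rewrite modn_small ?eqxx ?orbT //.
  by rewrite prednK // ltnW.
- exists (x %/ k).*2; rewrite /V_pm odd_double doubleK.
  by rewrite -[in LHS]def_r -divn_eq.
- exists (x %/ k).*2.+1; rewrite /V_pm /= odd_double uphalf_double.
  by rewrite -[in LHS]def_r -divn_eq.
Qed.

(** The bound on [k] is sharp: [1 + 1 = -1] modulo 3. *)
Lemma GD_V_pm k : 3 < k -> GD (V_pm k).
Proof.
move=> k_gt3; apply: (@GD_residues k (fun r => (r == 1) || (r == k.-1))).
- apply: increasing_step => n; rewrite /V_pm /= uphalf_half.
  by case: (odd n); rewrite /= ?add1n ?add0n ?mulSn; lia.
- by move=> x; apply: is_term_V_pm; lia.
- move=> r s /orP[]/eqP-> /orP[]/eqP->; rewrite ?mul1n ?muln1.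
  + by rewrite modn_small //; lia.
  + by rewrite modn_small ?eqxx ?orbT //; lia.
  + by rewrite modn_small ?eqxx ?orbT //; lia.
  + have -> : k.-1 * k.-1 = k.-2 * k + 1 by nia.
    by rewrite modnMDl modn_small //; lia.
- move=> r s /orP[]/eqP-> /orP[]/eqP->.
  + by rewrite modn_small; lia.
  + have -> : 1 + k.-1 = k by lia.
    by rewrite modnn; lia.
  + have -> : k.-1 + 1 = k by lia.
    by rewrite modnn; lia.
  + have -> : k.-1 + k.-1 = 1 * k + k.-2 by lia.
    by rewrite modnMDl modn_small; lia.
Qed.

Lemma not_maximal_GD_V k : 3 < k -> ~ maximal_GD (V k).
Proof.
move=> k_gt3; have k_gt1 : 1 < k by lia.
apply: (@not_maximal_GD_terms _ (V_pm k) k.-1 (GD_V _ k_gt1) (GD_V_pm _ k_gt3)).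
- move=> n; apply/(is_term_V_pm _ _ k_gt1)/orP; left.
  by apply/(is_term_V _ _ k_gt1); exists n.
- by apply/(is_term_V_pm _ _ k_gt1); rewrite modn_small ?eqxx ?orbT //; lia.
- by move/(is_term_V _ _ k_gt1); rewrite modn_small; lia.
Qed.

(** * Powers *)

(** If [i <= j], then [k ^ j < k ^ i + k ^ j <= 2 * k ^ j < k ^ j.+1]. *)
Lemma sum_powers_not_power k i j l : 2 < k -> k ^ l <> k ^ i + k ^ j.
Proof.
move=> k_gt2; have k_gt1 : 1 < k by lia.
wlog le_ij : i j / i <= j => [IH|].
  by case/orP: (leq_total i j) => /IH //; rewrite addnC.
move=> def_kl; have le_kikj : k ^ i <= k ^ j by rewrite leq_exp2l.
have ki_gt0 : 0 < k ^ i by rewrite expn_gt0; lia.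
have lt_jl : j < l by rewrite -(ltn_exp2l _ _ k_gt1); lia.
have : k ^ j.+1 <= k ^ l by rewrite leq_exp2l.
rewrite expnS; nia.
Qed.

Lemma GD_W k : 2 < k -> GD (W k).
Proof.
move=> k_gt2; split=> [m n lt_mn|n|n m|n m [l]].
- by rewrite /W ltn_exp2l //; lia.
- by rewrite /W expn_gt0; lia.
- by exists (m + n); rewrite /W expnD.
- exact: sum_powers_not_power.
Qed.

Lemma not_maximal_GD_W k : 2 < k -> ~ maximal_GD (W k).
Proof.
move=> k_gt2; have pk_gt1 : 1 < k.-1 by lia.
apply: (@not_maximal_GD_terms _ (V k.-1) (2 * k).-1 (GD_W _ k_gt2) (GD_V _ pk_gt1)).
- move=> n; apply/(is_term_V _ _ pk_gt1); rewrite /W -modnXm.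
  have k1 : k %% k.-1 = 1.
    by rewrite -[in X in X %% _](prednK (ltnW (ltnW k_gt2))) -addn1 modnDl modn_small.
  by rewrite k1 exp1n modn_small.
- by exists 2; rewrite /V; lia.
- (* k ^ 1 < 2 * k - 1 < k ^ 2 *)
  case=> n; rewrite /W; case: n => [|[|n]]; rewrite ?expn0 ?expn1; try lia.
  have kn_gt0 : 0 < k ^ n by rewrite expn_gt0; lia.
  rewrite !expnS; nia.
Qed.

Theorem theorem5 :
  ((forall k : nat, k = 2 \/ k = 3 -> maximal_GD (V k)) /\
   (forall k : nat, 4 <= k -> GD (V k) /\ ~ maximal_GD (V k))) /\
  (forall k : nat, 3 <= k -> GD (W k) /\ ~ maximal_GD (W k)).
Proof.
split; first split=> [k [->|->]|k k_gt3].
- exact: maximal_GD_V2.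
- exact: maximal_GD_V3.
- by split; [apply: GD_V; lia | apply: not_maximal_GD_V].
- by move=> k k_gt2; split; [apply: GD_W | apply: not_maximal_GD_W].
Qed.
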